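(* Let $P=L$, let $1\le K\le L$, $K<M$, let $l_1,\dots,l_K\in\{1,\dots,L\}$ be distinct, let $\phi_1,\dots,\phi_K\in\mathbb R$ be pairwise distinct modulo $2\pi$, let $\mathbf R_{\mathbf S}\in\mathbb C^{K\times K}$ be Hermitian positive semidefinite with positive diagonal entries, and let $\sigma^2>0$, $T>0$. Let $$\mathrm{CRB}_{sub}=\frac{\sigma^2}{2T}\Big(\Re\big((\mathbf E^{\mathrm H}\mathbf P_{\mathbf G_{\mathcal S}}\mathbf E)\odot\mathbf R_{\mathbf S}^{\mathrm H}\big)\Big)^{-1},\qquad \mathrm{CRB}_{Ny}=\frac{\sigma^2}{2T}\Big(\Re\big((\mathbf D^{\mathrm H}\mathbf P_{\mathbf A}\mathbf D)\odot\mathbf R_{\mathbf S}^{\mathrm H}\big)\Big)^{-1},$$ where the matrix inverted in $\mathrm{CRB}_{Ny}$ is assumed invertible. Then: (i) if $K=1$, $\mathrm{CRB}_{sub}=\mathrm{CRB}_{Ny}$; (ii) if $K>1$, $(\mathrm{CRB}_{sub})_{kk}\le(\mathrm{CRB}_{Ny})_{kk}$ for every $k=1,\dots,K$.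
   Context: Notation: $j=\sqrt{-1}$; $\odot$ is the Hadamard product; $*$ is the Khatri--Rao (column-wise Kronecker) product; $\Re$ is the entrywise real part; $\mathbf P_{\mathbf X}=\mathbf I-\mathbf X(\mathbf X^{\mathrm H}\mathbf X)^{-1}\mathbf X^{\mathrm H}$ for a full-column-rank matrix $\mathbf X$. $\mathbf A=[\mathbf a(\phi_1),\dots,\mathbf a(\phi_K)]\in\mathbb C^{M\times K}$ is the manifold matrix of a uniform linear array of $M$ sensors, $\mathbf a(\phi)=[1,\exp(j\phi),\dots,\exp(j\phi(M-1))]^{\mathrm T}$, and $\mathbf D=[\mathbf a'(\phi_1),\dots,\mathbf a'(\phi_K)]$ with $\mathbf a'=d\mathbf a/d\phi$. $\mathbf B\in\mathbb C^{P\times L}$ has entries $B_{il}=\frac1{\sqrt L}\exp(j\frac{2\pi}{L}c_i l)$, $1\le i\le P$, $1\le l\le L$, for a sampling pattern of integers $0\le c_1<\dots<c_P\le L-1$ (so when $P=L$, $c_i=i-1$). $\mathbf B_\Omega$ is the $P\times K$ matrix whose $k$th column is the $l_k$th column of $\mathbf B$. $\mathbf G_{\mathcal S}=\mathbf A*\mathbf B_\Omega$, and $\mathbf E$ is the matrix whose $i$th column is the derivative of the $i$th column of $\mathbf G_{\mathcal S}$ with respect to $\phi_i$. $\mathrm{CRB}_{sub}$ and $\mathrm{CRB}_{Ny}$ are the Cram\'er--Rao bounds on $[\phi_1,\dots,\phi_K]$ for the sub-Nyquist model (branch number $P$, sampling-rate reduction factor $L$) and for Nyquist sampling, respectively. 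*)

(* Defs.v *)
From mathcomp Require Import all_boot all_order all_algebra.
From mathcomp Require Import complex mxtens.
From mathcomp Require Import all_classical all_reals all_analysis.

Set Implicit Arguments.
Unset Strict Implicit.
Unset Printing Implicit Defensive.

Import Order.TTheory GRing.Theory Num.Theory.
Import numFieldNormedType.Exports.

Local Open Scope ring_scope.
Local Open Scope complex_scope.
Local Open Scope sesquilinear_scope.

(* All indices are 0-based: sensor m, branch i, sub-band l and source k stand
   for the mathematical indices m + 1, i + 1, l + 1 and k + 1. *)

Section MatrixOperations.
Variable C : numClosedFieldType.

Definition hadamard m n (X Y : 'M[C]_(m, n)) : 'M[C]_(m, n) :=
  map2_mx *%R X Y.

Definition khatri_rao m p n (X : 'M[C]_(m, n)) (Y : 'M[C]_(p, n)) :
    'M[C]_(m * p, n) :=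
  \matrix_(r, k) (col k X *t col k Y) r ord0.

(* Meaningful when X has full column rank: invmx is the identity on singular
   matrices. *)
Definition orth_proj m n (X : 'M[C]_(m, n)) : 'M[C]_m :=
  1%:M - X *m invmx (X^t* *m X) *m X^t*.

(* The order on C makes "0 <= z" mean that z is real and nonnegative. *)
Definition hermitian_psd n (X : 'M[C]_n) : Prop :=
  X \is hermsymmx /\ forall v : 'cV[C]_n, 0 <= (v^t* *m X *m v) 0 0.

End MatrixOperations.

Section Array.
Variable R : realType.
Implicit Types t : R.

Definition expi t : R[i] := cos t +i* sin t.

(* Derivative of a matrix-valued function of a real variable, taken on the
   real and imaginary parts of each entry. *)
Definition deriv_mx m n (F : R -> 'M[R[i]]_(m, n)) t : 'M[R[i]]_(m, n) :=
  \matrix_(r, k) (derive1 (fun s => complex.Re (F s r k)) t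
                  +i* derive1 (fun s => complex.Im (F s r k)) t).

Definition steering M t : 'cV[R[i]]_M := \col_m expi (t * m%:R).

Definition manifold M K (phi : 'I_K -> R) : 'M[R[i]]_(M, K) :=
  \matrix_(m, k) steering M (phi k) m 0.

Definition manifold_deriv M K (phi : 'I_K -> R) : 'M[R[i]]_(M, K) :=
  \matrix_(m, k) deriv_mx (steering M) (phi k) m 0.

(* The 0-based column l carries the exponent of the mathematical index l + 1. *)
Definition sampling_mx P L (c : 'I_P -> 'I_L) : 'M[R[i]]_(P, L) :=
  \matrix_(i, l) ((Num.sqrt L%:R)^-1%:C
                  * expi (2 * pi / L%:R * (c i)%:R * (l.+1)%:R)).

Definition G_S M P L K (c : 'I_P -> 'I_L) (l : 'I_K -> 'I_L)
    (phi : 'I_K -> R) : 'M[R[i]]_(M * P, K) :=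
  khatri_rao (manifold M phi) (colsub l (sampling_mx c)).

(* Column k is the partial derivative in phi_k of column k of G_S. *)
Definition G_S_deriv M P L K (c : 'I_P -> 'I_L) (l : 'I_K -> 'I_L)
    (phi : 'I_K -> R) : 'M[R[i]]_(M * P, K) :=
  \matrix_(r, k)
    deriv_mx (fun t => col k (G_S M c l [eta phi with k |-> t])) (phi k) r 0.

(* The matrix inverted in the bounds: Re ((Y^H P_X Y) o RS^H). *)
Definition info_mx N K (X Y : 'M[R[i]]_(N, K)) (RS : 'M[R[i]]_K) : 'M[R]_K :=
  map_mx (@complex.Re R) (hadamard (Y^t* *m orth_proj X *m Y) (RS^t*)).

Definition info_sub M P L K (c : 'I_P -> 'I_L) (l : 'I_K -> 'I_L)
    (phi : 'I_K -> R) (RS : 'M[R[i]]_K) : 'M[R]_K :=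
  info_mx (G_S M c l phi) (G_S_deriv M c l phi) RS.

Definition info_Ny M K (phi : 'I_K -> R) (RS : 'M[R[i]]_K) : 'M[R]_K :=
  info_mx (manifold M phi) (manifold_deriv M phi) RS.

Definition CRB_sub M P L K (c : 'I_P -> 'I_L) (l : 'I_K -> 'I_L)
    (phi : 'I_K -> R) (RS : 'M[R[i]]_K) (sigma T : R) : 'M[R]_K :=
  (sigma ^+ 2 / (2 * T)) *: invmx (info_sub M c l phi RS).

Definition CRB_Ny M K (phi : 'I_K -> R) (RS : 'M[R[i]]_K) (sigma T : R) :
    'M[R]_K :=
  (sigma ^+ 2 / (2 * T)) *: invmx (info_Ny M phi RS).

End Array.

(* Main.v *)
(* When [P = L] the columns of [B_Omega] are orthonormal, so the Gram matrices of
   [A * B_Omega] and [D * B_Omega] are diagonal: the sub-Nyquist information matrix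
   is diagonal with entries [s_k = RS_kk |P_{a_k} d_k|^2], where [P_{a_k}] projects
   away from the single column [a_k]. The Nyquist information matrix [J] projects
   away from all the columns of [A], so [J_kk <= s_k]. As [J] is positive definite,
   [(J^-1)_kk >= 1 / J_kk >= 1 / s_k]; for [K = 1] the two projections agree. *)
Require Import Defs.
From mathcomp Require Import all_boot all_order all_algebra.
From mathcomp Require Import complex mxtens ring lra zify.
From mathcomp Require Import all_classical all_reals all_analysis.

Import Order.TTheory GRing.Theory Num.Theory.
Local Open Scope ring_scope.
Local Open Scope sesquilinear_scope.

(** * Conjugate transposes and Gram matrices *)

Section ConjugateTranspose.
Context {C : numClosedFieldType}.

Lemma trmxC_mul m n p (X : 'M[C]_(m, n)) (Y : 'M[C]_(n, p)) :
  (X *m Y)^t* = Y^t* *m X^t*.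
Proof. by rewrite trmx_mul map_mxM. Qed.

Lemma trmxCB m n (X Y : 'M[C]_(m, n)) : (X - Y)^t* = X^t* - Y^t*.
Proof. by rewrite raddfB map_mxB. Qed.

Lemma trmxC1 n : (1%:M : 'M[C]_n)^t* = 1%:M.
Proof. by rewrite trmx1 map_mx1. Qed.

Lemma trmxC_inv n (X : 'M[C]_n) : (invmx X)^t* = invmx (X^t*).
Proof. by rewrite trmx_inv map_invmx. Qed.

Lemma gram_diagE m n (X : 'M[C]_(m, n)) k :
  (X^t* *m X) k k = \sum_i `|X i k| ^+ 2.
Proof. by rewrite !mxE; apply: eq_bigr => i _; rewrite !mxE mulrC normCK. Qed.

Lemma gram_diag_ge0 m n (X : 'M[C]_(m, n)) k : 0 <= (X^t* *m X) k k.
Proof. by rewrite gram_diagE sumr_ge0 // => i _; rewrite exprn_ge0. Qed.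

(** If [X^t* *m X *m v = 0], then the squared norm of [X *m v] vanishes, so injectivity of [X] gives
    [v = 0]. *)
Lemma gram_unitmx m n (X : 'M[C]_(m, n)) :
  (forall v : 'cV_n, X *m v = 0 -> v = 0) -> X^t* *m X \in unitmx.
Proof.
(* [kermx] is a left kernel, hence the passage to the transposed Gram matrix. *)
move=> Xinj; rewrite -unitmx_tr -row_free_unit -kermx_eq0.
apply/eqP/row_matrixP => i; rewrite row0.
set u := row i _.
have uK : u *m (X^t* *m X)^T = 0 by rewrite /u -row_mul mulmx_ker row0.
have GuT : X^t* *m (X *m u^T) = 0.
  by apply: trmx_inj; rewrite mulmxA trmx_mul trmxK uK trmx0.
have norm0 : ((X *m u^T)^t* *m (X *m u^T)) 0 0 = 0.
  by rewrite trmxC_mul -mulmxA GuT mulmx0 mxE.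
apply: trmx_inj; rewrite trmx0; apply: Xinj; apply/matrixP => r s.
move: norm0; rewrite gram_diagE => /psumr_eq0P norm0.
rewrite [s]ord1 [RHS]mxE; apply/eqP; rewrite -normr_eq0 -sqrf_eq0.
by rewrite norm0 // => j _; rewrite exprn_ge0.
Qed.

End ConjugateTranspose.

(** * Projection onto the orthogonal complement of a range *)

Section OrthogonalProjection.
Context {C : numClosedFieldType}.

Lemma orth_proj_sandwichE N K (X Y : 'M[C]_(N, K)) :
  Y^t* *m orth_proj X *m Y =
  Y^t* *m Y - Y^t* *m X *m invmx (X^t* *m X) *m (X^t* *m Y).
Proof. by rewrite /orth_proj mulmxBr mulmxBl mulmx1 !mulmxA. Qed.

Lemma orth_projC N K (X : 'M[C]_(N, K)) : (orth_proj X)^t* = orth_proj X.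
Proof.
rewrite /orth_proj trmxCB trmxC1 2!trmxC_mul trmxC_inv trmxC_mul !trmxCK.
by rewrite mulmxA.
Qed.

Context {N K : nat} {X : 'M[C]_(N, K)}.
Hypothesis unitX : X^t* *m X \in unitmx.

Lemma orth_proj_mull : orth_proj X *m X = 0.
Proof. by rewrite /orth_proj mulmxBl mul1mx -!mulmxA mulVmx // mulmx1 subrr. Qed.

Lemma orth_projK : orth_proj X *m orth_proj X = orth_proj X.
Proof. by rewrite {2}/orth_proj mulmxBr mulmx1 !mulmxA orth_proj_mull !mul0mx subr0. Qed.

(** The projection is Hermitian and idempotent. The Gram form makes the sandwich positive
    semidefinite. *)
Lemma orth_proj_gram p (Y : 'M[C]_(N, p)) :
  Y^t* *m orth_proj X *m Y = (orth_proj X *m Y)^t* *m (orth_proj X *m Y).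
Proof. by rewrite trmxC_mul orth_projC -[in RHS]mulmxA (mulmxA (orth_proj X)) orth_projK mulmxA. Qed.

(* The left-hand side is the squared distance from [col k Y] to the range of [X]. *)
Lemma orth_proj_min p (Y : 'M[C]_(N, p)) (V : 'M[C]_(K, p)) k :
  (Y^t* *m orth_proj X *m Y) k k <= ((Y - X *m V)^t* *m (Y - X *m V)) k k.
Proof.
set U : 'M[C]_(N, p) := Y - X *m V.
have PU : orth_proj X *m U = orth_proj X *m Y.
  by rewrite /U mulmxBr mulmxA orth_proj_mull mul0mx subr0.
rewrite orth_proj_gram -PU -orth_proj_gram; clearbody U => {PU}.
(* Pythagoras: the squared norms of [U] and of its projection differ by that of
   [U - orth_proj X *m U]. *)
suff : U^t* *m U - U^t* *m orth_proj X *m U =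
       (U - orth_proj X *m U)^t* *m (U - orth_proj X *m U).
  move=> dec; have := gram_diag_ge0 _ _ (U - orth_proj X *m U) k.
  by rewrite -dec !mxE subr_ge0.
move: (orth_proj X) (orth_projC _ _ X) (orth_proj_gram _ U) => P PC PG.
by rewrite trmxCB mulmxBl !mulmxBr -PG trmxC_mul PC !mulmxA subrr subr0.
Qed.

End OrthogonalProjection.

(** * Hermitian forms and the Schur product theorem *)

Section PositiveSemidefinite.
Context {C : numClosedFieldType}.

Lemma quad_formE (D : pzRingType) m n (u : 'rV[D]_m) (X : 'M[D]_(m, n)) (v : 'cV[D]_n) :
  (u *m X *m v) 0 0 = \sum_i \sum_j u 0 i * X i j * v j 0.
Proof.
rewrite mxE exchange_big; apply: eq_bigr => j _ /=.
by rewrite mxE mulr_suml.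
Qed.

Lemma hermsymmxP n (X : 'M[C]_n) : reflect (X^t* = X) (X \is hermsymmx).
Proof.
by rewrite is_hermitianmxE expr0 scale1r eq_sym; apply: eqP.
Qed.

(* The form of [(X^H X) o H] at [z] is the sum over the rows [r] of [X] of the
   form of [H] at the vector [(X_rj z_j)_j]. *)
Lemma hadamard_gram_psd m n (X : 'M[C]_(m, n)) (H : 'M[C]_n) :
  hermitian_psd H -> hermitian_psd (hadamard (X^t* *m X) H).
Proof.
case=> /hermsymmxP Hherm Hpos; split.
  apply/hermsymmxP/matrixP => i j; rewrite !mxE rmorphM /=; congr (_ * _).
    rewrite rmorph_sum; apply: eq_bigr => r _.
    by rewrite !mxE rmorphM /= conjCK mulrC.
  by rewrite -[in RHS]Hherm !mxE.
move=> z.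
suff -> : (z^t* *m hadamard (X^t* *m X) H *m z) 0 0 =
    \sum_r ((\col_j (X r j * z j 0))^t* *m H *m (\col_j (X r j * z j 0))) 0 0.
  by apply: sumr_ge0 => r _; apply: Hpos.
rewrite quad_formE [RHS](eq_bigr _ (fun r _ => quad_formE _ _ _ _ _ _)).
rewrite [RHS]exchange_big; apply: eq_bigr => i _ /=.
rewrite [RHS]exchange_big; apply: eq_bigr => j _ /=.
rewrite !mxE mulr_suml mulr_sumr mulr_suml; apply: eq_bigr => r _.
by rewrite !mxE rmorphM /=; ring.
Qed.

End PositiveSemidefinite.

(** * Diagonal entries of inverses of real symmetric matrices *)

Section RealSymmetric.
Context {F : realFieldType} {n : nat} {J : 'M[F]_n}.
Hypothesis symJ : J^T = J.
Hypothesis psdJ : forall x : 'cV[F]_n, 0 <= (x^T *m J *m x) 0 0.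
Hypothesis unitJ : J \in unitmx.

(* The form of [J] at [J^-1 e_k - t e_k]. *)
Lemma invmx_diag_quadratic k t : 0 <= invmx J k k - t *+ 2 + t ^+ 2 * J k k.
Proof.
set e : 'cV[F]_n := delta_mx k 0; set u := invmx J *m e.
have eE (Z : 'M[F]_n) : (e^T *m Z *m e) 0 0 = Z k k.
  by rewrite trmx_delta -rowE -colE !mxE.
have ee : (e^T *m e) 0 0 = 1 by rewrite -[e^T]mulmx1 eE mxE eqxx.
(* By symmetry both cross terms of the form reduce to [e^T *m e], that is, to 1. *)
have uJ : u^T *m J = e^T by rewrite trmx_mul trmx_inv symJ -mulmxA mulVmx ?mulmx1.
have Ju : J *m u = e by rewrite mulmxA mulmxV ?mul1mx.
have eu : (e^T *m u) 0 0 = invmx J k k by rewrite mulmxA eE.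
have mB (a b : 'M[F]_1) : (a - b) 0 0 = a 0 0 - b 0 0 by rewrite !mxE.
have mZ x (a : 'M[F]_1) : (x *: a) 0 0 = x * a 0 0 by rewrite mxE.
have := psdJ (u - t *: e).
have -> : (u - t *: e)^T = u^T - t *: e^T by rewrite linearB linearZ.
rewrite mulmxBl uJ mulmxBr 2!mulmxBl.
rewrite -!scalemxAl -!scalemxAr -!mulmxA Ju mulmxA !mB !mZ eE ee eu.
lra.
Qed.

(** Let a be the diagonal entry of the inverse. The quadratic at 0 gives a >= 0; if [J k k <= 0],
    its value at a + 1 is at most - a - 2 < 0. *)
Lemma psd_unit_diag_gt0 k : 0 < J k k.
Proof.
rewrite ltNge; apply/negP => Jk.
have := invmx_diag_quadratic k (invmx J k k + 1).
have : (invmx J k k + 1) ^+ 2 * J k k <= 0 by rewrite mulr_ge0_le0 ?sqr_ge0.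
have := invmx_diag_quadratic k 0; rewrite expr0n mul0r mul0rn /=.
lra.
Qed.

(** The quadratic is evaluated at [s^-1], where its last term is at most [s^-1]. *)
Lemma invmx_diag_ge k s : J k k <= s -> s^-1 <= invmx J k k.
Proof.
move=> Js; have s0 : 0 < s := lt_le_trans (psd_unit_diag_gt0 k) Js.
have := invmx_diag_quadratic k s^-1.
have : s^-1 ^+ 2 * J k k <= s^-1.
  rewrite expr2 -mulrA; apply: ler_piMr; first by rewrite invr_ge0 ltW.
  by rewrite mulrC ler_pdivrMr // mul1r.
lra.
Qed.

End RealSymmetric.

(** * Gram matrices and projections of Khatri-Rao products *)

Section KhatriRao.
Context {C : numClosedFieldType}.

(** The inner product of two Kronecker products of vectors factors into the inner products of the
    factors. *)
Lemma khatri_rao_gram m p n (X X' : 'M[C]_(m, n)) (Y Y' : 'M[C]_(p, n)) :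
  (khatri_rao X Y)^t* *m khatri_rao X' Y' =
  hadamard (X^t* *m X') (Y^t* *m Y').
Proof.
apply/matrixP => i j; rewrite !mxE mulr_sum; apply: eq_bigr => r _.
by rewrite !mxE rmorphM /= mulrACA.
Qed.

Lemma hadamard_scalar1 n (X : 'M[C]_n) :
  hadamard X 1%:M = diag_mx (\row_k X k k).
Proof.
apply/matrixP => i j; rewrite !mxE; case: eqP => [->|_]; first by rewrite mulr1.
by rewrite mulr0.
Qed.

(* Orthonormal columns of [B] make the Gram matrices of the Khatri-Rao products
   diagonal, so each column of [D] is only projected away from the column of [A]
   with the same index. *)
Lemma orth_proj_khatri_rao N P K (A D : 'M[C]_(N, K)) (B : 'M[C]_(P, K)) m
    (V := diag_mx (\row_k (m^-1 * (A^t* *m D) k k))) :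
  B^t* *m B = 1%:M -> (forall k, (A^t* *m A) k k = m) -> m != 0 ->
  (khatri_rao D B)^t* *m orth_proj (khatri_rao A B) *m khatri_rao D B =
  diag_mx (\row_k ((D - A *m V)^t* *m (D - A *m V)) k k).
Proof.
move=> BB AA m0.
rewrite orth_proj_sandwichE !khatri_rao_gram BB !hadamard_scalar1.
have -> : diag_mx (\row_k (A^t* *m A) k k) = m%:M.
  by apply/matrixP => i j; rewrite mxE (mxE _ _ 0) AA [RHS]mxE.
rewrite invmx_scalar mul_mx_scalar -scalemxAl mulmx_diag.
have VR n (Z : 'M[C]_(n, K)) i k : (Z *m V) i k = Z i k * (m^-1 * (A^t* *m D) k k).
  by rewrite /V mul_mx_diag 2!mxE.
have VL n (Z : 'M[C]_(K, n)) k j : (V^t* *m Z) k j = (m^-1 * (A^t* *m D) k k)^* * Z k j.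
  by rewrite /V tr_diag_mx map_diag_mx mul_diag_mx 3!mxE.
(* Column k of [A *m V] is the projection of column k of [D] onto column k of [A], whose squared
   norm is [m]; two of the three correction terms therefore cancel. *)
have E k : ((D - A *m V)^t* *m (D - A *m V)) k k =
    (D^t* *m D) k k - m^-1 * ((D^t* *m A) k k * (A^t* *m D) k k).
  rewrite trmxCB mulmxBl !mulmxBr trmxC_mul mulmxA -!mulmxA.
  have mB (a b : 'M[C]_K) : (a - b) k k = a k k - b k k by rewrite !mxE.
  rewrite !mB !VL !mulmxA !VR AA.
  by rewrite mulVKf // subrr subr0 mulrCA.
apply/matrixP => i j; rewrite !mxE.
case: eqVneq => [_|_]; last by rewrite !mulr0n mulr0 subr0.
by rewrite !mulr1n; have := E i; rewrite !mxE => ->.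
Qed.

(** With a single column, the Hadamard factor [B^t* *m B] is the scalar 1 and leaves every Gram
    matrix unchanged; this yields the equality for [K = 1]. *)
Lemma orth_proj_khatri_rao1 N P (A D : 'M[C]_(N, 1)) (B : 'M[C]_(P, 1)) :
  B^t* *m B = 1%:M ->
  (khatri_rao D B)^t* *m orth_proj (khatri_rao A B) *m khatri_rao D B =
  D^t* *m orth_proj A *m D.
Proof.
move=> BB; rewrite !orth_proj_sandwichE !khatri_rao_gram BB.
have h1 (Z : 'M[C]_1) : hadamard Z 1%:M = Z.
  by apply/matrixP => i j; rewrite !ord1 !mxE mulr1.
by rewrite !h1.
Qed.

End KhatriRao.

(** * The exponential on the unit circle and its period *)

Section Exponential.
Context {R : realType}.
Implicit Types s t : R.

Lemma expi0 : expi (0 : R) = 1.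
Proof. by rewrite /expi cos0 sin0. Qed.

Lemma expiD s t : expi (s + t) = expi s * expi t.
Proof.
rewrite /expi cosD sinD; apply/eqP; rewrite eq_complex /= eqxx /=.
by rewrite addrC mulrC [X in _ == X + _]mulrC [X in X + _]mulrC; apply/eqP; ring.
Qed.

Lemma expiN t : expi (- t) = (expi t)^*.
Proof. by rewrite /expi cosN sinN. Qed.

Lemma expiB s t : expi (s - t) = expi s * (expi t)^*.
Proof. by rewrite expiD expiN. Qed.

Lemma expiMn t n : expi (t * n%:R) = expi t ^+ n.
Proof.
elim: n => [|n IHn]; first by rewrite mulr0 expi0 expr0.
by rewrite -natr1 mulrDr mulr1 expiD IHn exprSr.
Qed.

Lemma norm_expi t : `|expi t| = 1.
Proof. by rewrite normc_def /= cos2Dsin2 sqrtr1. Qed.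

Lemma expi_2pi : expi (2 * pi : R) = 1.
Proof. by rewrite mulr_natl /expi cos2pi sin2pi. Qed.

Lemma expi_intM2pi (n : int) : expi (n%:~R * (2 * pi) : R) = 1.
Proof.
have expi_nat (m : nat) : expi (m%:R * (2 * pi) : R) = 1.
  by rewrite mulrC expiMn expi_2pi expr1n.
case: n => m; first exact: expi_nat.
by rewrite NegzE rmorphN mulNr expiN expi_nat rmorph1.
Qed.

(** Removing full turns leaves [r] in [0, 2 pi), so its half [s] lies in [0, pi). Then cos (2 s) = 1
    forces sin s = 0, hence [s = 0]. *)
Lemma expi_eq1 t : expi t = 1 -> exists n : int, t = n%:~R * (2 * pi).
Proof.
move=> expit1; have pi_gt0 : 0 < pi :> R := pi_gt0 R.
pose n := Num.floor (t / (2 * pi)); exists n.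
pose r := t - n%:~R * (2 * pi); pose s := r / 2.
have : expi r = 1 by rewrite expiB expit1 expi_intM2pi rmorph1 mulr1.
have r2s : r = s *+ 2 by rewrite /s mulr2n; field.
case=> cosr _; have : sin s ^+ 2 = 0.
  by rewrite sin2cos2; move: cosr; rewrite r2s cos_mulr2n; lra.
move/eqP; rewrite sqrf_eq0 => /eqP sins.
have /andP[] := floor_itv (t / (2 * pi)); rewrite -/n.
rewrite ler_pdivlMr ?ltr_pdivrMr ?mulr_gt0 // rmorphD mulrDl mul1r => lb ub.
have s_lt_pi : s < pi by rewrite /s /r; lra.
have s_ge0 : 0 <= s by rewrite /s /r; lra.
have : ~ (0 < s) by move=> s0; have := @sin_gt0_pi R s; rewrite s0 s_lt_pi sins ltxx => /(_ isT).
by move=> /negP; rewrite -leNgt /s /r; lra.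
Qed.


End Exponential.

(** * Differentiation of the Khatri-Rao columns *)

Section Derivatives.
Context {R : realType}.

Lemma derive1_complexMr (f : R -> R[i]) (b : R[i]) (t : R) :
  derivable (fun s => complex.Re (f s)) t 1 ->
  derivable (fun s => complex.Im (f s)) t 1 ->
  (derive1 (fun s => complex.Re (f s * b)) t
   +i* derive1 (fun s => complex.Im (f s * b)) t)%C =
  (derive1 (fun s => complex.Re (f s)) t
   +i* derive1 (fun s => complex.Im (f s)) t)%C * b.
Proof.
case: b => u v dRe dIm.
have dM (g : R -> R) w : derivable g t 1 -> derivable (fun s => g s * w) t 1.
  by move=> dg; apply: derivableM => //; exact: derivable_cst.
have -> : (fun s => complex.Re (f s * (u +i* v)%C)) =
    (fun s => complex.Re (f s) * u) - (fun s => complex.Im (f s) * v).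
  by apply/funext => s; rewrite !fctE; case: (f s).
have -> : (fun s => complex.Im (f s * (u +i* v)%C)) =
    (fun s => complex.Re (f s) * v) + (fun s => complex.Im (f s) * u).
  by apply/funext => s; rewrite !fctE; case: (f s).
rewrite !derive1E deriveB ?deriveD; try exact: dM.
by rewrite -!derive1E !derive1Mr.
Qed.

Lemma derivable_comp_mulr (g : R -> R) (a t : R) :
  (forall x, derivable g x 1) -> derivable (fun s : R => g (s * a)) t 1.
Proof.
move=> dg.
have d : derivable (fun s : R => s * a) t 1.
  by apply: derivableM; [exact: derivable_id | exact: derivable_cst].
by case: (@is_derive1_comp R g ( *%R^~ a) t _ _ (derivableP (dg _)) (derivableP d)).
Qed.

(** The sampling factor does not depend on the phase, so the derivative falls on the steering vector
    alone. *)
Lemma G_S_derivE M P L K (c : 'I_P -> 'I_L) (l : 'I_K -> 'I_L) (phi : 'I_K -> R) :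
  G_S_deriv M c l phi = khatri_rao (manifold_deriv M phi) (colsub l (sampling_mx R c)).
Proof.
apply/matrixP => r k; rewrite !mxE.
set m := (mxtens_unindex r).1; set b := (X in _ = _ * X).
have steeringE s : steering M s m 0 = expi (s * m%:R) by rewrite mxE.
rewrite -(derive1_complexMr (fun s => steering M s m 0)).
- congr (derive1 _ _ +i* derive1 _ _)%C; apply/funext => s.
    by rewrite /b !mxE /= eqxx.
  by rewrite /b !mxE /= eqxx.
- under eq_fun do rewrite steeringE.
  by apply: derivable_comp_mulr => x; exact: derivable_cos.
- under eq_fun do rewrite steeringE.
  by apply: derivable_comp_mulr => x; exact: derivable_sin.
Qed.

End Derivatives.

(** * Orthonormality of the square sampling matrix *)

Section Sampling.
Context {R : realType}.

(** An injective [c] permutes the rows of a discrete Fourier matrix, so inner products of columns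
    are geometric sums over [L]-th roots of unity. *)
Lemma sampling_mx_orthonormal L (c : 'I_L -> 'I_L) : injective c ->
  (sampling_mx R c)^t* *m sampling_mx R c = 1%:M.
Proof.
move=> cinj; apply/matrixP => i j; rewrite !mxE.
have L0 : (0 < L)%N by case: L i {c cinj j} => [[]|].
have LR : (L%:R : R) != 0 by rewrite pnatr_eq0 -lt0n.
pose th : R := 2 * pi / L%:R * (j.+1%:R - i.+1%:R).
transitivity (\sum_(r < L) ((L%:R)^-1 : R[i]) * expi th ^+ r).
  rewrite [RHS](reindex_inj cinj); apply: eq_bigr => r _; rewrite !mxE rmorphM /=.
  rewrite -[expi th ^+ _]expiMn mulrACA [X in _ * X = _]mulrC -expiB.
  have -> : 2 * pi / L%:R * (c r)%:R * j.+1%:R - 2 * pi / L%:R * (c r)%:R * i.+1%:R = th * (c r)%:R.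
    by rewrite /th; ring.
  congr (_ * _); rewrite [_^*]conjc_real -rmorphM -invfM -expr2 sqr_sqrtr ?ler0n //.
  by rewrite fmorphV rmorph_nat.
rewrite -mulr_sumr.
case: eqVneq => [ij|ij].
  rewrite /th ij subrr mulr0 expi0; under eq_bigr do rewrite expr1n.
  by rewrite sumr_const card_ord mulVf // pnatr_eq0 -lt0n.
suff -> : \sum_(r < L) expi th ^+ r = 0 by rewrite mulr0.
have : (expi th - 1) * \sum_(r < L) expi th ^+ r = 0.
  rewrite -subrX1 -expiMn.
  have -> : th * L%:R = (j.+1%:Z - i.+1%:Z)%:~R * (2 * pi).
    by rewrite /th rmorphB /=; field.
  by rewrite expi_intM2pi subrr.
move/eqP; rewrite mulf_eq0 subr_eq0 => /orP[/eqP /expi_eq1 [n thn]|/eqP //].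
(* A ratio equal to 1 would make [j - i] a multiple of [L], which is impossible for distinct indices
   below [L]. *)
have : ((j.+1%:Z - i.+1%:Z)%:~R : R) = (n * L%:Z)%:~R.
  have pi0 : (pi : R) != 0 by rewrite gt_eqF ?pi_gt0.
  apply: (mulIf (_ : 2 * pi != 0 :> R)); first by rewrite mulf_neq0 ?pnatr_eq0.
  rewrite rmorphM /= mulrAC -thn /th rmorphB /=; field.
  exact: LR.
move/intr_inj => eqn.
case/eqP: ij; apply: val_inj => /=.
move: (val i) (val j) (ltn_ord i) (ltn_ord j) eqn => /= a b aL bL.
case: n {thn} => [[|n]|n] eqn; [lia | nia | nia].
Qed.

End Sampling.

(** * Gram matrix of the array manifold *)

Section Manifold.
Context {R : realType}.

Lemma expi_eq_mod2pi (s t : R) :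
  expi s = expi t -> exists n : int, s - t = n%:~R * (2 * pi).
Proof.
by move=> est; apply: expi_eq1; rewrite expiB est -normCK norm_expi expr1n.
Qed.

Lemma manifold_gram_diag M K (phi : 'I_K -> R) k :
  ((manifold M phi)^t* *m manifold M phi) k k = M%:R.
Proof.
rewrite gram_diagE (eq_bigr (fun=> 1)) ?sumr_const ?card_ord // => m _.
by rewrite !mxE norm_expi expr1n.
Qed.

(** The first [K] rows form a Vandermonde matrix with distinct nodes, so the manifold matrix is
    injective. *)
Lemma manifold_gram_unitmx M K (phi : 'I_K -> R) : (K <= M)%N ->
  injective (fun k => expi (phi k)) ->
  (manifold M phi)^t* *m manifold M phi \in unitmx.
Proof.
move=> KM phi_inj; apply: gram_unitmx => v Av0.
pose W := Vandermonde K (\row_k expi (phi k)).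
have WE : W = rowsub (widen_ord KM) (manifold M phi).
  by apply/matrixP => i j; rewrite !mxE expiMn.
have unitW : W \in unitmx.
  rewrite unitmxE unitfE det_Vandermonde; apply/prodf_neq0 => i _.
  apply/prodf_neq0 => j ij; rewrite !mxE subr_eq0.
  by apply: contraTneq ij => /phi_inj ->; rewrite ltnn.
have Wv0 : W *m v = 0 by rewrite WE mul_rowsub_mx Av0; apply/matrixP => i j; rewrite !mxE.
by rewrite -[v](mulKmx unitW) Wv0 mulmx0.
Qed.

End Manifold.

(** * Information matrices: positivity and comparison *)

Section Information.
Context {R : realType}.

Lemma map_Re_sym n (H : 'M[R[i]]_n) : H \is hermsymmx ->
  (map_mx (@complex.Re R) H)^T = map_mx (@complex.Re R) H.
Proof.
move=> /hermsymmxP HH; apply/matrixP => i j; rewrite !mxE -[in RHS]HH !mxE.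
by case: (H j i).
Qed.

(** On real vectors, the form of the real part is the real part of the form. *)
Lemma map_Re_psd n (H : 'M[R[i]]_n) : hermitian_psd H ->
  forall x : 'cV[R]_n, 0 <= (x^T *m map_mx (@complex.Re R) H *m x) 0 0.
Proof.
case=> _ Hpos x.
have ReD : {morph @complex.Re R : z w / z + w} by move=> [a b] [c d].
have Re_sum := big_morph (@complex.Re R) ReD (erefl : complex.Re 0 = 0 :> R).
have := Hpos (map_mx (real_complex R) x); rewrite lecE => /andP[_] /=.
congr (_ <= _); rewrite !quad_formE Re_sum; apply: eq_bigr => i _.
rewrite Re_sum; apply: eq_bigr => j _; rewrite !mxE [_^*]conjc_real.
by case: (H i j) => a b /=; rewrite !mul0r !mulr0 !subr0.
Qed.

Context {N K : nat} {RS : 'M[R[i]]_K}.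
Hypothesis RSpsd : hermitian_psd RS.

Lemma RS_trmxC : RS^t* = RS.
Proof. by case: RSpsd => /hermsymmxP. Qed.

Section Projected.
Context {X : 'M[R[i]]_(N, K)} (Y : 'M[R[i]]_(N, K)).
Hypothesis unitX : X^t* *m X \in unitmx.

Lemma hadamard_sandwich_psd :
  hermitian_psd (hadamard (Y^t* *m orth_proj X *m Y) (RS^t*)).
Proof.
by rewrite orth_proj_gram // RS_trmxC; apply: hadamard_gram_psd.
Qed.

Lemma info_mx_sym : (info_mx X Y RS)^T = info_mx X Y RS.
Proof. by apply: map_Re_sym; case: hadamard_sandwich_psd. Qed.

Lemma info_mx_psd (x : 'cV[R]_K) : 0 <= (x^T *m info_mx X Y RS *m x) 0 0.
Proof. exact/map_Re_psd/hadamard_sandwich_psd. Qed.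

End Projected.

(** The matrix [V] of single-column projections serves twice: its residuals give the diagonal
    exactly, and it is a competitor in [orth_proj_min]. *)
Lemma info_mx_khatri_rao_diag P (A D : 'M[R[i]]_(N, K)) (B : 'M[R[i]]_(P, K)) m :
  A^t* *m A \in unitmx -> B^t* *m B = 1%:M ->
  (forall k, (A^t* *m A) k k = m) -> m != 0 -> (forall k, 0 <= RS k k) ->
  exists2 s : 'rV[R]_K,
    info_mx (khatri_rao A B) (khatri_rao D B) RS = diag_mx s &
    forall k, info_mx A D RS k k <= s 0 k.
Proof.
move=> unitA BB AA m0 RS0.
set V := diag_mx (\row_k (m^-1 * (A^t* *m D) k k)).
exists (\row_k complex.Re (((D - A *m V)^t* *m (D - A *m V)) k k * RS k k)).
  rewrite /info_mx RS_trmxC (orth_proj_khatri_rao _ _ _ _ _ _ _ BB AA m0) -/V.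
  apply/matrixP => i j; rewrite !mxE; case: eqVneq => [->|_]; first by [].
  by rewrite !mulr0n mul0r.
move=> k; rewrite /info_mx RS_trmxC.
have := ler_wpM2r (RS0 k) (orth_proj_min unitA _ D V k).
rewrite lecE => /andP[_]; by rewrite !mxE.
Qed.

End Information.

(** * Inverses of diagonal matrices and comparison of the bounds *)

Lemma diag_mx_unitmx (F : fieldType) n (s : 'rV[F]_n) :
  (forall k, s 0 k != 0) -> diag_mx s \in unitmx.
Proof.
by move=> s0; rewrite unitmxE det_diag unitfE; apply/prodf_neq0 => k _.
Qed.

Lemma invmx_diag (F : fieldType) n (s : 'rV[F]_n) :
  (forall k, s 0 k != 0) -> invmx (diag_mx s) = diag_mx (map_mx GRing.inv s).
Proof.
move=> s0; apply: (can_inj (mulKmx (diag_mx_unitmx _ _ _ s0))).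
rewrite mulmxV ?diag_mx_unitmx // mulmx_diag; apply/matrixP => i j.
by rewrite !mxE mulfV.
Qed.

Theorem mainTheorem4 (R : realType) (M P L K : nat)
  (c : 'I_P -> 'I_L) (l : 'I_K -> 'I_L) (phi : 'I_K -> R)
  (RS : 'M[R[i]]_K) (sigma T : R)
  (hPL : P = L) (hK : (1 <= K <= L)%N) (hKM : (K < M)%N)
  (hc : forall i i' : 'I_P, (i < i')%N -> (c i < c i')%N)
  (hl : injective l)
  (hphi : forall k k' : 'I_K, k != k' ->
     ~ exists n : int, phi k - phi k' = n%:~R * (2 * pi))
  (hRS : hermitian_psd RS)
  (hRSdiag : forall k : 'I_K, 0 < RS k k)
  (hsigma : 0 < sigma ^+ 2) (hT : 0 < T)
  (hNy : info_Ny M phi RS \in unitmx) :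
  info_sub M c l phi RS \in unitmx
  /\ (K = 1%N -> CRB_sub M c l phi RS sigma T = CRB_Ny M phi RS sigma T)
  /\ ((1 < K)%N -> forall k : 'I_K,
        CRB_sub M c l phi RS sigma T k k <= CRB_Ny M phi RS sigma T k k).
Proof.
subst P; have c_inj : injective c.
  move=> i j cij; case: (ltngtP i j) => [/hc|/hc|/val_inj //].
    by rewrite cij ltnn.
  by rewrite cij ltnn.
set B := colsub l (sampling_mx R c).
have BB : B^t* *m B = 1%:M.
  have /matrixP SS := @sampling_mx_orthonormal R _ _ c_inj.
  apply/matrixP => i j; have := SS (l i) (l j); rewrite !mxE (inj_eq hl) => <-.
  by apply: eq_bigr => r _; rewrite !mxE.
have AA := manifold_gram_diag M K phi.
have M0 : (M%:R : R[i]) != 0 by rewrite pnatr_eq0 -lt0n (leq_ltn_trans _ hKM).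
have unitA : (manifold M phi)^t* *m manifold M phi \in unitmx.
  apply: manifold_gram_unitmx => [|k k' /expi_eq_mod2pi]; first exact: ltnW.
  by move=> kk'; case: (eqVneq k k') => // /hphi /(_ kk').
have RS0 k : 0 <= RS k k := ltW (hRSdiag k).
have [s subE Ny_le_s] :=
  info_mx_khatri_rao_diag hRS _ _ (manifold_deriv M phi) _ _ unitA BB AA M0 RS0.
have subE' : info_sub M c l phi RS = diag_mx s by rewrite -subE /info_sub G_S_derivE.
have Ny_sym := info_mx_sym hRS (manifold_deriv M phi) unitA.
have Ny_psd := info_mx_psd hRS (manifold_deriv M phi) unitA.
(* Invertibility of the Nyquist matrix makes its diagonal positive, and this passes to the larger
   [s]. *)
have s_gt0 k : 0 < s 0 k.
  exact: lt_le_trans (psd_unit_diag_gt0 Ny_sym Ny_psd hNy k) (Ny_le_s k).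
have s_neq0 k : s 0 k != 0 by rewrite gt_eqF.
(* As [invmx] fixes singular matrices, this is what makes [CRB_sub] a genuine inverse. *)
split; first by rewrite subE' diag_mx_unitmx.
split=> [K1|_ k].
  rewrite /CRB_sub /CRB_Ny /info_sub /info_Ny /info_mx G_S_derivE /G_S.
  congr (_ *: invmx (map_mx _ (hadamard _ _))).
  clear -K1 BB; subst K.
  exact: orth_proj_khatri_rao1.
rewrite /CRB_sub /CRB_Ny subE' invmx_diag // [leLHS]mxE [leRHS]mxE.
apply: ler_wpM2l.
  by apply: divr_ge0; [exact: ltW | rewrite mulr_ge0 ?ler0n ?ltW].
rewrite !mxE eqxx mulr1n.
exact: (invmx_diag_ge Ny_sym Ny_psd hNy) (Ny_le_s k).
Qed.
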